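(* Let $P$ be a finite set of points in the Euclidean plane with $|P|$ even, and let $M$ be a $3$-local maximum perfect matching on $P$. Let $M^*$ be a maximum-length perfect matching on $P$. Then $w(M)\geqslant \frac{1}{\sqrt{2}}\, w(M^* )$.
   Context: A perfect matching on a finite point set $P$ in the plane is a partition of $P$ into pairs; each pair $\{a,b\}$ is regarded as the straight-line segment (edge) $ab$. For a set $E$ of segments, $w(E)$ denotes the sum of the Euclidean lengths of its segments. A perfect matching $M$ on $P$ is a maximum-length (globally maximum) matching if $w(M)\geqslant w(M')$ for every perfect matching $M'$ on $P$. For an integer $k$, a perfect matching $M$ is $k$-local maximum if for every subset $M'=\{a_1b_1,\dots,a_kb_k\}$ of $k$ edges of $M$, $M'$ is a maximum-length perfect matching on the point set $\{a_1,b_1,\dots,a_k,b_k\}$.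
   Formalization: The formal theorem assumes |P| ≥ 6 (M has at least 3 edges); with two edges every matching is vacuously 3-local maximum and the claim fails, e.g. collinear points 0,1,2,3 with M={01,23} of weight 2 against optimum 4. *)

(* Defs.v *)
(* concrete reals R, points in R*R, finite point sets as duplicate-free lists. *)
From Stdlib Require Import Reals Lra List Permutation.
Open Scope R_scope.

Definition point : Type := (R * R)%type.

Definition dist (a b : point) : R :=
  sqrt ((fst a - fst b) ^ 2 + (snd a - snd b) ^ 2).

(* A segment (edge) is an unordered pair, represented by an ordered pair. *)
Definition edge : Type := (point * point)%type.

Definition endpoints (E : list edge) : list point :=
  flat_map (fun e => fst e :: snd e :: nil) E.

Definition w (E : list edge) : R :=
  fold_right Rplus 0 (map (fun e => dist (fst e) (snd e)) E).

(* M is a perfect matching on the (duplicate-free) point list P: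
   the endpoints of the edges of M enumerate P exactly once each. *)
Definition perfect_matching (P : list point) (M : list edge) : Prop :=
  Permutation (endpoints M) P.

Definition max_matching (P : list point) (M : list edge) : Prop :=
  perfect_matching P M /\
  forall M' : list edge, perfect_matching P M' -> w M' <= w M.

(* M is k-local maximum: for every subset M' of k edges of M (a sub-multiset,
   i.e. M is a permutation of M' ++ rest), M' is a maximum-length perfect
   matching on the endpoints of M'. *)
Definition k_local_max (k : nat) (M : list edge) : Prop :=
  forall M' rest : list edge,
    Permutation M (M' ++ rest) -> length M' = k ->
    max_matching (endpoints M') M'.

(* Main.v *)
(** For an edge [ab] of [M] let [excess x ab = |xa| + |xb| - sqrt 2 |ab|]. If some
    [x] makes every excess nonpositive, then summing the distances from [x] to all
    points of [P] gives [w Mstar <= sum <= sqrt 2 * w M].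

    Such an [x] is a minimiser of the largest excess. Suppose that the minimum is
    positive. At [x] each active edge (one attaining the maximum) is seen under an
    angle less than 90 degrees, and the bisectors of these angles do not lie in an
    open half-plane, since otherwise moving [x] would decrease the maximum.
    Hence either two bisectors form an angle of at least 135 degrees, or three of
    them have consecutive gaps between 90 and 180 degrees. In both cases the
    endpoints of the two or three edges can be rematched so that every new edge is
    seen from [x] under an angle of at least 90 degrees. A segment [pq] seen under
    such an angle satisfies [sqrt 2 |pq| >= |xp| + |xq|], so the new matching is
    longer, against 3-local maximality. *)
Require Import Defs.
From Stdlib Require Import Reals List Permutation.
From Stdlib Require Import Lra Lia ClassicalEpsilon.
(* [Reals] shadows [dist]. *)
Import Defs.
Open Scope R_scope.

(** * Vectors and distances in the plane *)

Definition vsub (a b : point) : point := (fst a - fst b, snd a - snd b).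
Definition dot (u v : point) : R := fst u * fst v + snd u * snd v.
Definition cross (u v : point) : R := fst u * snd v - snd u * fst v.
(* [g] rotated by the angle [atan s] and rescaled. *)
Definition tilt (s : R) (g : point) : point :=
  (fst g - s * snd g, snd g + s * fst g).
Definition scale (c : R) (u : point) : point := (c * fst u, c * snd u).
Definition vadd (u v : point) : point := (fst u + fst v, snd u + snd v).

Lemma dist_dot (a b : point) : dist a b = sqrt (dot (vsub a b) (vsub a b)).
Proof. unfold dist, dot, vsub; simpl; f_equal; ring. Qed.

Lemma dot_self_nonneg (u : point) : 0 <= dot u u.
Proof. unfold dot; nra. Qed.

Lemma dist_nonneg (a b : point) : 0 <= dist a b.
Proof. apply sqrt_pos. Qed.

Lemma dist_sqr (a b : point) : dist a b * dist a b = dot (vsub a b) (vsub a b).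
Proof. rewrite dist_dot; apply sqrt_sqrt, dot_self_nonneg. Qed.

Lemma dist_sym (a b : point) : dist a b = dist b a.
Proof. unfold dist; f_equal; ring. Qed.

Lemma dist_triangle (a b c : point) : dist a c <= dist a b + dist b c.
Proof.
  pose proof (dist_nonneg a b). pose proof (dist_nonneg b c).
  apply Rsqr_incr_0_var; [|lra]. unfold Rsqr.
  pose proof (dist_sqr a b) as H1. pose proof (dist_sqr b c) as H2.
  rewrite dist_sqr.
  assert (HC : dot (vsub a b) (vsub b c) <= dist a b * dist b c).
  { apply Rsqr_incr_0_var; [|nra]. unfold Rsqr.
    replace (dist a b * dist b c * (dist a b * dist b c))
      with ((dist a b * dist a b) * (dist b c * dist b c)) by ring.
    rewrite H1, H2. unfold dot, vsub; simpl.
    pose proof (pow2_ge_0 ((fst a - fst b) * (snd b - snd c)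
                           - (snd a - snd b) * (fst b - fst c))). nra. }
  replace (dot (vsub a c) (vsub a c))
    with (dot (vsub a b) (vsub a b) + dot (vsub b c) (vsub b c)
          + 2 * dot (vsub a b) (vsub b c)) by (unfold dot, vsub; simpl; ring).
  nra.
Qed.

Lemma dist_le_abs (a b : point) :
  dist a b <= Rabs (fst a - fst b) + Rabs (snd a - snd b).
Proof.
  pose proof (Rabs_pos (fst a - fst b)). pose proof (Rabs_pos (snd a - snd b)).
  apply Rsqr_incr_0_var; [|lra]. unfold Rsqr. rewrite dist_sqr.
  unfold dot, vsub; simpl.
  pose proof (Rsqr_abs (fst a - fst b)) as H1.
  pose proof (Rsqr_abs (snd a - snd b)) as H2. unfold Rsqr in *.
  rewrite H1, H2. nra.
Qed.

Lemma abs_fst_le_dist (a b : point) : Rabs (fst a - fst b) <= dist a b.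
Proof.
  apply Rsqr_incr_0_var; [|apply dist_nonneg]. rewrite <- Rsqr_abs.
  unfold Rsqr. rewrite dist_sqr. unfold dot, vsub; simpl.
  pose proof (pow2_ge_0 (snd a - snd b)). lra.
Qed.

Lemma abs_snd_le_dist (a b : point) : Rabs (snd a - snd b) <= dist a b.
Proof.
  apply Rsqr_incr_0_var; [|apply dist_nonneg]. rewrite <- Rsqr_abs.
  unfold Rsqr. rewrite dist_sqr. unfold dot, vsub; simpl.
  pose proof (pow2_ge_0 (fst a - fst b)). lra.
Qed.

(** By the law of cosines [|ab|^2 >= |xa|^2 + |xb|^2], and twice the right-hand side is at least
    [(|xa| + |xb|)^2]. *)
Lemma obtuse_dist (x a b : point) :
  dot (vsub a x) (vsub b x) <= 0 -> dist x a + dist x b <= sqrt 2 * dist a b.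
Proof.
  intros H. pose proof (dist_nonneg x a). pose proof (dist_nonneg x b).
  pose proof (dist_nonneg a b). pose proof (sqrt_pos 2).
  apply Rsqr_incr_0_var; [|nra]. unfold Rsqr.
  replace (sqrt 2 * dist a b * (sqrt 2 * dist a b))
    with ((sqrt 2 * sqrt 2) * (dist a b * dist a b)) by ring.
  rewrite sqrt_sqrt by lra.
  pose proof (dist_sqr x a). pose proof (dist_sqr x b). rewrite (dist_sqr a b).
  replace (dot (vsub a b) (vsub a b))
    with (dot (vsub x a) (vsub x a) + dot (vsub x b) (vsub x b)
          - 2 * dot (vsub a x) (vsub b x)) by (unfold dot, vsub; simpl; ring).
  pose proof (pow2_ge_0 (dist x a - dist x b)). nra.
Qed.

(** * Minimisers of coercive Lipschitz functions *)

(** The one-variable extreme value theorem is applied twice on a square: first along each row, with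
    a row minimiser [X y] given by choice, then to the row minimum as a function of [y]. *)
Lemma lipschitz_min_2d (F : point -> R) (L K : R) :
  0 <= L ->
  (forall p q, F p <= F q + L * (Rabs (fst p - fst q) + Rabs (snd p - snd q))) ->
  (forall p, K < Rabs (fst p) \/ K < Rabs (snd p) -> F (0, 0) <= F p) ->
  exists m, forall p, F m <= F p.
Proof.
  intros HL Lip Coer.
  (* [K] may be negative; the absolute value keeps the origin in the square. *)
  set (B := Rabs K).
  assert (HB : 0 <= B) by apply Rabs_pos.
  assert (HKB : K <= B) by apply Rle_abs.
  assert (lip_cont : forall h : R -> R,
    (forall s t, h s <= h t + L * Rabs (s - t)) -> forall c, continuity_pt h c).
  { intros h Hh c eps Heps. exists (eps / (L + 1)). split.
    { apply Rdiv_lt_0_compat; lra. }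
    intros t [_ Ht]. simpl in *. unfold Rdist in *.
    pose proof (Hh t c). pose proof (Hh c t). rewrite (Rabs_minus_sym c t) in *.
    assert (Rabs (t - c) * (L + 1) < eps).
    { apply Rmult_lt_reg_r with (/ (L + 1)). apply Rinv_0_lt_compat; lra.
      rewrite Rmult_assoc, Rinv_r, Rmult_1_r by lra. exact Ht. }
    pose proof (Rabs_pos (t - c)). apply Rabs_def1; nra. }
  assert (Hrow : forall y, exists x, - B <= x <= B /\ forall c, - B <= c <= B -> F (x, y) <= F (c, y)).
  { intros y. destruct (continuity_ab_min (fun x => F (x, y)) (- B) B) as [x [Hx Hb]].
    - lra.
    - intros c _. apply lip_cont. intros s t. pose proof (Lip (s, y) (t, y)) as HH.
      simpl in HH. rewrite Rminus_diag, Rabs_R0 in HH. lra.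
    - exists x. split; assumption. }
  apply choice in Hrow. destruct Hrow as [X HX].
  destruct (continuity_ab_min (fun y => F (X y, y)) (- B) B) as [y [Hy _]].
  - lra.
  (* The row minimum inherits the Lipschitz bound although [X] may jump: [X t] competes in row [s],
     so [F (X s, s) <= F (X t, s) <= F (X t, t) + L |s - t|]. *)
  - intros c _. apply lip_cont. intros s t.
    destruct (HX s) as [_ Hs]. destruct (HX t) as [Ht _].
    specialize (Hs _ Ht). pose proof (Lip (X t, s) (X t, t)) as HH.
    simpl in HH. rewrite Rminus_diag, Rabs_R0 in HH. lra.
  - exists (X y, y).
    assert (Hin : forall p, - B <= fst p <= B -> - B <= snd p <= B -> F (X y, y) <= F p).
    { intros [p1 p2] H1 H2; simpl in *. specialize (Hy _ H2).
      destruct (HX p2) as [_ Hp]. specialize (Hp _ H1). lra. }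
    intros p.
    destruct (Rlt_le_dec K (Rabs (fst p))) as [H1|H1];
      [|destruct (Rlt_le_dec K (Rabs (snd p))) as [H2|H2]].
    + apply Rle_trans with (F (0, 0)); [apply Hin; simpl; lra | auto].
    + apply Rle_trans with (F (0, 0)); [apply Hin; simpl; lra | auto].
    + assert (bnd : forall r, Rabs r <= B -> - B <= r <= B).
      { intros r Hr. pose proof (Rle_abs r). pose proof (Rle_abs (- r)).
        rewrite Rabs_Ropp in *. lra. }
      apply Hin; apply bnd; lra.
Qed.

(** * Planar vectors in an open half-plane *)

(** The angles between three vectors in positive balance add up to 360 degrees. The last two
    hypotheses put two of them below 135 degrees, so the third is at least 90. *)
Lemma balanced_triple_dot (g h k : point) (p q r : R) :
  0 < p -> 0 < q -> 0 < r ->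
  vadd (scale p g) (vadd (scale q h) (scale r k)) = (0, 0) ->
  - dot g k < Rabs (cross g k) -> - dot h k < Rabs (cross h k) ->
  dot g h <= 0.
Proof.
  intros Hp Hq Hr E H1 H2. apply Rnot_lt_le. intros HD.
  assert (Ek : scale r k = vadd (scale (- p) g) (scale (- q) h)).
  { destruct g, h, k. unfold vadd, scale in *; simpl in *. injection E. intros.
    f_equal; lra. }
  assert (E1 : r * cross g k = - q * cross g h).
  { transitivity (cross g (scale r k)); [|rewrite Ek];
      unfold cross, vadd, scale; simpl; ring. }
  assert (E2 : r * cross h k = p * cross g h).
  { transitivity (cross h (scale r k)); [|rewrite Ek];
      unfold cross, vadd, scale; simpl; ring. }
  assert (E3 : r * dot g k = - p * dot g g - q * dot g h).
  { transitivity (dot g (scale r k)); [|rewrite Ek];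
      unfold dot, vadd, scale; simpl; ring. }
  assert (E4 : r * dot h k = - p * dot g h - q * dot h h).
  { transitivity (dot h (scale r k)); [|rewrite Ek];
      unfold dot, vadd, scale; simpl; ring. }
  apply (Rmult_lt_compat_l r _ _ Hr) in H1, H2.
  assert (F1 : r * Rabs (cross g k) = q * Rabs (cross g h)).
  { rewrite <- (Rabs_pos_eq r), <- Rabs_mult, E1, Rabs_mult, Rabs_Ropp by lra.
    rewrite (Rabs_pos_eq q); lra. }
  assert (F2 : r * Rabs (cross h k) = p * Rabs (cross g h)).
  { rewrite <- (Rabs_pos_eq r), <- Rabs_mult, E2, Rabs_mult by lra.
    rewrite (Rabs_pos_eq p); lra. }
  rewrite F1, Ropp_mult_distr_r_reverse, E3 in H1.
  rewrite F2, Ropp_mult_distr_r_reverse, E4 in H2.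
  assert (Lag : Rabs (cross g h) * Rabs (cross g h) + dot g h * dot g h
                = dot g g * dot h h).
  { pose proof (Rsqr_abs (cross g h)) as F. unfold Rsqr in F. rewrite <- F.
    unfold dot, cross; ring. }
  pose proof (dot_self_nonneg g). pose proof (dot_self_nonneg h).
  clear E E1 E2 E3 E4 F1 F2 Ek.
  set (X := Rabs (cross g h)) in *. set (D := dot g h) in *.
  set (A := dot g g) in *. set (C := dot h h) in *.
  clearbody X D A C.
  (* The product of the two inequalities [p A + q D < q X] and
     [p D + q C < p X] contradicts Lagrange's identity. *)
  assert ((p * A + q * D) * (p * D + q * C) < (q * X) * (p * X)).
  { apply Rmult_le_0_lt_compat; nra. }
  assert (0 < p * q) by nra.
  assert (0 <= p * p * (A * D)) by (apply Rmult_le_pos; nra).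
  assert (0 <= q * q * (C * D)) by (apply Rmult_le_pos; nra).
  assert (0 < p * q * (D * D)) by (apply Rmult_lt_0_compat; nra).
  nra.
Qed.

(* The second hypothesis says that all pairwise angles are below 135 degrees. *)
Lemma half_plane_of_no_spread (G : list point) :
  (forall g, In g G -> 0 < dot g g) ->
  (forall g h, In g G -> In h G -> - dot g h < Rabs (cross g h)) ->
  (forall g h k, In g G -> In h G -> In k G ->
     dot g h <= 0 -> dot h k <= 0 -> dot k g <= 0 ->
     0 <= cross g h -> 0 <= cross h k -> 0 <= cross k g -> False) ->
  exists d, forall g, In g G -> 0 < dot g d.
Proof.
  intros Hnz Hpair Htri.
  (* By induction, the whole list lies in the cone spanned by two of its members, possibly parallel
     ones. *)
  assert (cone : G = nil \/ exists g h, In g G /\ In h G /\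
    forall k, In k G -> exists p q, 0 <= p /\ 0 <= q /\ k = vadd (scale p g) (scale q h)).
  { induction G as [|n G IH]; [left; reflexivity|right].
    destruct IH as [->|[g [h [Hg [Hh HG]]]]].
    - intros; apply Hnz; right; assumption.
    - intros; apply Hpair; right; assumption.
    - intros g h k Hg Hh Hk. apply Htri; right; assumption.
    - exists n, n. split; [left; reflexivity|split; [left; reflexivity|]].
      intros k [<-|[]]. exists 1, 0. split; [lra|split; [lra|]].
      destruct n; unfold vadd, scale; simpl; f_equal; ring.
    - assert (In n (n :: G)) by (left; reflexivity).
      assert (In g (n :: G)) by (right; assumption).
      assert (In h (n :: G)) by (right; assumption).
      pose proof (Hpair g h ltac:(assumption) ltac:(assumption)) as Pgh.
      pose proof (Hpair g n ltac:(assumption) ltac:(assumption)) as Pgn.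
      pose proof (Hpair h n ltac:(assumption) ltac:(assumption)) as Phn.
      pose proof (Hnz g ltac:(assumption)) as Ng.
      pose proof (Hnz h ltac:(assumption)) as Nh.
      (* If [g] and [h] are parallel, [Pgh] gives [0 < dot g h]; the old cone is then a ray, and [n]
         and [g] span the new one. *)
      destruct (Req_dec (cross g h) 0) as [Xgh|Xgh].
      + rewrite Xgh, Rabs_R0 in Pgh.
        assert (Eh : h = scale (dot g h / dot g g) g).
        { destruct g as [g1 g2], h as [h1 h2].
          unfold dot, cross, scale in *; simpl in *.
          pose proof (f_equal (Rmult g1) Xgh). pose proof (f_equal (Rmult g2) Xgh).
          f_equal; apply Rmult_eq_reg_l with (g1 * g1 + g2 * g2); try lra;
            unfold Rdiv; rewrite (Rmult_comm _ (/ _)), Rmult_assoc,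
              <- (Rmult_assoc _ (/ _)), Rinv_r, Rmult_1_l by lra; lra. }
        assert (Hl : 0 < dot g h / dot g g) by (apply Rdiv_lt_0_compat; lra).
        set (l := dot g h / dot g g) in *. clearbody l.
        exists n, g. split; [assumption|split; [assumption|]].
        intros k [<-|Hk].
        * exists 1, 0. split; [lra|split; [lra|]].
          destruct n; unfold vadd, scale; simpl; f_equal; ring.
        * destruct (HG k Hk) as [p [q [Hp [Hq ->]]]].
          exists 0, (p + q * l). split; [lra|split; [nra|]].
          rewrite Eh. unfold vadd, scale; simpl; f_equal; ring.
      (* Cramer's rule gives the coordinates of [n] in the basis [g], [h]. If both are nonnegative,
         the cone is unchanged; if just one is negative, [n] replaces the generator with the other
         coordinate, which cannot vanish because [n] would then be opposite to a generator. *)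
      + pose (p := cross n h / cross g h). pose (q := cross g n / cross g h).
        assert (En : n = vadd (scale p g) (scale q h)).
        { unfold p, q. destruct n, g, h. unfold vadd, scale, cross in *; simpl in *.
          f_equal; field; exact Xgh. }
        clearbody p q.
        destruct (Rle_lt_dec 0 p) as [Hp|Hp]; destruct (Rle_lt_dec 0 q) as [Hq|Hq].
        * exists g, h. split; [assumption|split; [assumption|]].
          intros k [<-|Hk]; [exists p, q; auto|auto].
        * destruct (Rle_lt_or_eq_dec 0 p Hp) as [Hp'|<-].
          -- exists n, h. split; [assumption|split; [assumption|]].
             intros k [<-|Hk].
             ++ exists 1, 0. split; [lra|split; [lra|]].
                destruct n; unfold vadd, scale; simpl; f_equal; ring.
             ++ destruct (HG k Hk) as [p' [q' [Hp1 [Hq1 ->]]]].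
                exists (p' / p), (q' + p' / p * - q).
                assert (0 <= p' / p) by (apply Rle_mult_inv_pos; lra).
                split; [assumption|split; [nra|]].
                rewrite En. unfold vadd, scale; simpl; f_equal; field; lra.
          -- exfalso. revert Phn. rewrite En.
             replace (cross h (vadd (scale 0 g) (scale q h))) with 0
               by (unfold cross, vadd, scale; simpl; ring).
             replace (dot h (vadd (scale 0 g) (scale q h))) with (q * dot h h)
               by (unfold dot, vadd, scale; simpl; ring).
             rewrite Rabs_R0. nra.
        * destruct (Rle_lt_or_eq_dec 0 q Hq) as [Hq'|<-].
          -- exists g, n. split; [assumption|split; [assumption|]].
             intros k [<-|Hk].
             ++ exists 0, 1. split; [lra|split; [lra|]].
                destruct n; unfold vadd, scale; simpl; f_equal; ring.
             ++ destruct (HG k Hk) as [p' [q' [Hp1 [Hq1 ->]]]].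
                exists (p' + q' / q * - p), (q' / q).
                assert (0 <= q' / q) by (apply Rle_mult_inv_pos; lra).
                split; [nra|split; [assumption|]].
                rewrite En. unfold vadd, scale; simpl; f_equal; field; lra.
          -- exfalso. revert Pgn. rewrite En.
             replace (cross g (vadd (scale p g) (scale 0 h))) with 0
               by (unfold cross, vadd, scale; simpl; ring).
             replace (dot g (vadd (scale p g) (scale 0 h))) with (p * dot g g)
               by (unfold dot, vadd, scale; simpl; ring).
             rewrite Rabs_R0. nra.
        (* With both coordinates negative, [g], [h], [n] are in positive balance, so all three
           angles are at least 90 degrees. The sign of [cross g h] tells which cyclic order is
           counterclockwise. *)
        * exfalso.
          assert (symd : forall u v, dot u v = dot v u) by (intros; unfold dot; ring).
          assert (symc : forall u v, cross u v = - cross v u) by (intros; unfold cross; ring).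
          assert (absc : forall u v, Rabs (cross u v) = Rabs (cross v u)).
          { intros u v. rewrite (symc u v). apply Rabs_Ropp. }
          assert (Zero : vadd (scale (- p) g) (vadd (scale (- q) h) (scale 1 n)) = (0, 0)).
          { rewrite En. unfold vadd, scale; simpl; f_equal; ring. }
          assert (D1 : dot g h <= 0)
            by (apply (balanced_triple_dot g h n (- p) (- q) 1); auto; lra).
          assert (D2 : dot h n <= 0).
          { apply (balanced_triple_dot h n g (- q) 1 (- p)); try lra.
            - rewrite <- Zero. unfold vadd, scale; simpl; f_equal; ring.
            - rewrite symd, absc; assumption.
            - rewrite symd, absc; assumption. }
          assert (D3 : dot n g <= 0).
          { apply (balanced_triple_dot n g h 1 (- p) (- q)); try lra.
            - rewrite <- Zero. unfold vadd, scale; simpl; f_equal; ring.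
            - rewrite symd, absc; assumption. }
          assert (X1 : cross h n = - p * cross g h)
            by (rewrite En; unfold cross, vadd, scale; simpl; ring).
          assert (X2 : cross n g = - q * cross g h)
            by (rewrite En; unfold cross, vadd, scale; simpl; ring).
          destruct (Rle_lt_dec 0 (cross g h)).
          -- apply (Htri g h n); auto; nra.
          -- apply (Htri h g n); auto; rewrite symd || rewrite symc; auto; nra. }
  destruct cone as [->|[g [h [Hg [Hh HG]]]]].
  { exists (0, 0). intros g []. }
  assert (Hd : exists d, 0 < dot g d /\ 0 < dot h d).
  { destruct (Req_dec (cross g h) 0) as [X|X].
    - exists g. split; [auto|]. pose proof (Hpair g h Hg Hh) as P.
      rewrite X, Rabs_R0 in P. unfold dot in *. lra.
    (* The solution of [dot g d = dot h d = 1]. *)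
    - exists (scale (/ cross g h) (snd h - snd g, fst g - fst h)).
      unfold dot, scale, cross in *; simpl.
      split; match goal with |- 0 < ?e => replace e with 1 by (field; exact X) end; lra. }
  destruct Hd as [d [Hgd Hhd]]. exists d. intros k Hk.
  destruct (HG k Hk) as [p [q [Hp [Hq E]]]].
  pose proof (Hnz k Hk) as Nk.
  assert (Ed : dot k d = p * dot g d + q * dot h d)
    by (rewrite E; unfold dot, vadd, scale; simpl; ring).
  rewrite Ed.
  destruct (Rle_lt_or_eq_dec 0 p Hp) as [Hp'|Hp'];
    [|destruct (Rle_lt_or_eq_dec 0 q Hq) as [Hq'|Hq']]; try nra.
  subst p q. exfalso. rewrite E in Nk. unfold dot, vadd, scale in Nk; simpl in Nk. lra.
Qed.

(** * Excess of an edge and the bisector of its angle *)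

Definition excess (x : point) (e : edge) : R :=
  dist x (fst e) + dist x (snd e) - sqrt 2 * dist (fst e) (snd e).

Definition unit_to (x a : point) : point := scale (/ dist x a) (vsub a x).

(* The negated gradient of [excess] in [x]; it bisects the angle at [x]. *)
Definition pull (x : point) (e : edge) : point :=
  vadd (unit_to x (fst e)) (unit_to x (snd e)).

(** Lets the endpoints of an edge be named by their orientation around [x], whatever their stored
    order. *)
Definition joins (e : edge) (a b : point) : Prop := e = (a, b) \/ e = (b, a).

Lemma unit_to_norm (x a : point) :
  0 < dist x a -> dot (unit_to x a) (unit_to x a) = 1.
Proof.
  intros H. pose proof (dist_sqr x a) as E. unfold unit_to.
  replace (dot _ _) with (/ dist x a * / dist x a * dot (vsub x a) (vsub x a))
    by (unfold dot, scale, vsub; simpl; ring).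
  rewrite <- E. field. lra.
Qed.

(** [s] is the tangent of half the angle from [v] to [u], by [tan (r/2) = sin r / (1 + cos r)]. The
    angle is acute, so the half angle stays below 45 degrees. *)
Lemma unit_pair_tilt (u v : point) :
  dot u u = 1 -> dot v v = 1 -> 0 < dot u v ->
  let s := cross v u / (1 + dot u v) in
  Rabs s < 1 /\ u = scale (/ 2) (tilt s (vadd u v))
  /\ v = scale (/ 2) (tilt (- s) (vadd u v)).
Proof.
  intros Hu Hv Huv s.
  assert (Hs : s * (1 + dot u v) = cross v u) by (unfold s; field; lra).
  assert (Lag : cross v u * cross v u + dot u v * dot u v = 1).
  { transitivity (dot u u * dot v v); [|rewrite Hu, Hv; ring].
    unfold dot, cross; ring. }
  clearbody s.
  assert (K1 : fst u - fst v = - s * (snd u + snd v)).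
  { apply Rmult_eq_reg_r with (1 + dot u v); [|lra].
    transitivity (- (s * (1 + dot u v)) * (snd u + snd v)); [|ring]. rewrite Hs.
    destruct u as [a b], v as [c e]. unfold dot, cross in *; simpl in *.
    pose proof (f_equal (Rmult a) Hv). pose proof (f_equal (Rmult c) Hu).
    pose proof (f_equal (Rmult a) Hu). pose proof (f_equal (Rmult c) Hv). lra. }
  assert (K2 : snd u - snd v = s * (fst u + fst v)).
  { apply Rmult_eq_reg_r with (1 + dot u v); [|lra].
    transitivity ((s * (1 + dot u v)) * (fst u + fst v)); [|ring]. rewrite Hs.
    destruct u as [a b], v as [c e]. unfold dot, cross in *; simpl in *.
    pose proof (f_equal (Rmult b) Hv). pose proof (f_equal (Rmult e) Hu).
    pose proof (f_equal (Rmult b) Hu). pose proof (f_equal (Rmult e) Hv). lra. }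
  split; [|split].
  - apply Rabs_def1; nra.
  - destruct u, v; unfold scale, tilt, vadd in *; simpl in *; f_equal; lra.
  - destruct u, v; unfold scale, tilt, vadd in *; simpl in *; f_equal; lra.
Qed.

(** Contrapositive of [obtuse_dist]: the angle at [x] is acute, which also keeps both endpoints away
    from [x]. *)
Lemma excess_pos_dist (x : point) (e : edge) :
  0 < excess x e ->
  0 < dist x (fst e) /\ 0 < dist x (snd e)
  /\ 0 < dot (unit_to x (fst e)) (unit_to x (snd e)).
Proof.
  unfold excess. destruct e as [a b]; simpl. intros H.
  assert (Hd : 0 < dot (vsub a x) (vsub b x)).
  { apply Rnot_le_lt. intros Hd. apply obtuse_dist in Hd. lra. }
  assert (Hp : forall c, vsub c x <> (0, 0) -> 0 < dist x c).
  { intros c Hc. pose proof (dist_nonneg x c). pose proof (dist_sqr x c) as E.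
    destruct (Req_dec (dist x c) 0) as [Z|Z]; [|lra].
    exfalso. apply Hc. rewrite Z in E. unfold dot, vsub in *; simpl in *.
    destruct (Rplus_sqr_eq_0 (fst x - fst c) (snd x - snd c)); [unfold Rsqr; lra|].
    f_equal; lra. }
  assert (Ha : 0 < dist x a).
  { apply Hp. intros Z. rewrite Z in Hd. unfold dot in Hd; simpl in Hd. lra. }
  assert (Hb : 0 < dist x b).
  { apply Hp. intros Z. rewrite Z in Hd. unfold dot in Hd; simpl in Hd. lra. }
  split; [assumption|split; [assumption|]]. unfold unit_to.
  replace (dot _ _) with (/ dist x a * / dist x b * dot (vsub a x) (vsub b x))
    by (unfold dot, scale; simpl; ring).
  apply Rmult_lt_0_compat; [apply Rmult_lt_0_compat; apply Rinv_0_lt_compat|]; assumption.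
Qed.

Lemma pull_nonzero (x : point) (e : edge) :
  0 < excess x e -> 0 < dot (pull x e) (pull x e).
Proof.
  intros H. destruct (excess_pos_dist x e H) as [Ha [Hb Hd]].
  pose proof (unit_to_norm _ _ Ha) as U. pose proof (unit_to_norm _ _ Hb) as V.
  unfold pull. set (u := unit_to x (fst e)) in *. set (v := unit_to x (snd e)) in *.
  clearbody u v. unfold dot, vadd in *; simpl. lra.
Qed.

(** Normal form for the exchanges: [a] is the endpoint counterclockwise of the bisector and [b] the
    clockwise one. A negative tilt is repaired by swapping the two. *)
Lemma pull_tilt (x : point) (e : edge) :
  0 < excess x e ->
  exists a b s p q, joins e a b /\ 0 <= s < 1 /\ 0 < p /\ 0 < q
    /\ vsub a x = scale p (tilt s (pull x e))
    /\ vsub b x = scale q (tilt (- s) (pull x e)).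
Proof.
  intros H. destruct (excess_pos_dist x e H) as [Ha [Hb Hd]].
  destruct (unit_pair_tilt _ _ (unit_to_norm _ _ Ha) (unit_to_norm _ _ Hb) Hd)
    as [Hs [Eu Ev]].
  fold (pull x e) in Eu, Ev.
  destruct e as [a b]; simpl in *. set (s := cross _ _ / _) in *. clearbody s.
  assert (Hv : forall c r g, 0 < dist x c -> unit_to x c = scale (/ 2) (tilt r g) ->
                 vsub c x = scale (dist x c / 2) (tilt r g)).
  { intros c r g Hc E. unfold unit_to in E. destruct (vsub c x) as [v1 v2].
    unfold scale in *. injection E as E1 E2.
    apply (f_equal (Rmult (dist x c))) in E1, E2.
    rewrite <- Rmult_assoc, Rinv_r, Rmult_1_l in E1, E2 by lra.
    unfold tilt in *; simpl in *. f_equal; lra. }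
  apply Hv in Eu; [|assumption]. apply Hv in Ev; [|assumption].
  apply Rabs_def2 in Hs.
  destruct (Rle_lt_dec 0 s) as [Hs0|Hs0].
  - exists a, b, s, (dist x a / 2), (dist x b / 2).
    repeat split; try lra; try assumption. left; reflexivity.
  - exists b, a, (- s), (dist x b / 2), (dist x a / 2).
    rewrite Ropp_involutive.
    repeat split; try lra; try assumption. right; reflexivity.
Qed.

Lemma dot_tilt (p q s t : R) (g h : point) :
  dot (scale p (tilt s g)) (scale q (tilt t h))
  = p * q * ((1 + s * t) * dot g h + (s - t) * cross g h).
Proof. unfold dot, cross, scale, tilt; simpl; ring. Qed.

Lemma joins_excess (x : point) (e : edge) (a b : point) :
  joins e a b -> excess x e = dist x a + dist x b - sqrt 2 * dist a b.
Proof.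
  intros [-> | ->]; unfold excess; simpl; [ring|]. rewrite (dist_sym b a). ring.
Qed.

(** * Exchanges excluded by local maximality *)

Lemma local_max_exchange (M : list edge) (e1 e2 e3 : edge) (rest : list edge)
    (a1 b1 a2 b2 a3 b3 p1 q1 p2 q2 p3 q3 : point) :
  k_local_max 3 M -> Permutation M (e1 :: e2 :: e3 :: rest) ->
  joins e1 a1 b1 -> joins e2 a2 b2 -> joins e3 a3 b3 ->
  Permutation (p1 :: q1 :: p2 :: q2 :: p3 :: q3 :: nil)
    (a1 :: b1 :: a2 :: b2 :: a3 :: b3 :: nil) ->
  dist p1 q1 + dist p2 q2 + dist p3 q3 <= dist a1 b1 + dist a2 b2 + dist a3 b3.
Proof.
  intros HM HP J1 J2 J3 Hperm.
  destruct (HM (e1 :: e2 :: e3 :: nil) rest HP eq_refl) as [_ Hmax].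
  assert (E : forall e a b, joins e a b ->
    Permutation (a :: b :: nil) (fst e :: snd e :: nil) /\ dist (fst e) (snd e) = dist a b).
  { intros e a b [-> | ->]; simpl; split; auto using dist_sym, perm_swap. }
  destruct (E _ _ _ J1) as [P1 D1]. destruct (E _ _ _ J2) as [P2 D2].
  destruct (E _ _ _ J3) as [P3 D3].
  specialize (Hmax ((p1, q1) :: (p2, q2) :: (p3, q3) :: nil)).
  unfold w in Hmax; simpl in Hmax. rewrite D1, D2, D3 in Hmax.
  enough (perfect_matching (endpoints (e1 :: e2 :: e3 :: nil))
            ((p1, q1) :: (p2, q2) :: (p3, q3) :: nil)) as H
    by (specialize (Hmax H); lra).
  unfold perfect_matching; simpl. rewrite Hperm.
  exact (Permutation_app P1 (Permutation_app P2 P3)).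
Qed.

(** If the bisectors were at least 135 degrees apart, one could match counterclockwise endpoint with
    counterclockwise, and clockwise with clockwise. Both bisectors turn the same way by less than 45
    degrees, so the angle between them changes by less than 45 and stays obtuse. *)
Lemma local_max_pulls_not_spread (M : list edge) (x : point) (e f : edge) :
  k_local_max 3 M -> (3 <= length M)%nat -> In e M -> In f M ->
  0 < excess x e -> 0 < excess x f ->
  - dot (pull x e) (pull x f) < Rabs (cross (pull x e) (pull x f)).
Proof.
  intros HM Hlen He Hf Xe Xf. apply Rnot_le_lt. intros Hspread.
  assert (Hef : f <> e).
  { intros ->. pose proof (pull_nonzero x e Xe).
    pose proof (Rabs_pos (cross (pull x e) (pull x e))). lra. }
  destruct (in_split _ _ He) as [l1 [l2 ->]].
  assert (Hf' : In f (l1 ++ l2)).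
  { apply in_elt_inv in Hf. destruct Hf as [Hf|Hf]; [congruence|assumption]. }
  destruct (in_split _ _ Hf') as [l3 [l4 E]].
  assert (HP : Permutation (l1 ++ e :: l2) (e :: f :: l3 ++ l4)).
  { rewrite <- Permutation_middle, E, <- Permutation_middle. reflexivity. }
  pose proof (Permutation_length HP) as Hl. rewrite Hl in Hlen. simpl in Hlen.
  (* Local maximality speaks of exactly three edges, so a third edge [r] joins the exchange and is
     kept as it is. *)
  destruct (l3 ++ l4) as [|r rest].
  { simpl in Hlen. inversion Hlen as [|? H1]. inversion H1 as [|? H2]. inversion H2. }
  destruct (pull_tilt x e Xe) as [a1 [b1 [s [p1 [q1 [J1 [Hs [Hp1 [Hq1 [A1 B1]]]]]]]]]].
  destruct (pull_tilt x f Xf) as [a2 [b2 [t [p2 [q2 [J2 [Ht [Hp2 [Hq2 [A2 B2]]]]]]]]]].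
  assert (Hperm : Permutation (a1 :: a2 :: b1 :: b2 :: fst r :: snd r :: nil)
                    (a1 :: b1 :: a2 :: b2 :: fst r :: snd r :: nil))
    by (apply perm_skip, perm_swap).
  assert (J3 : joins r (fst r) (snd r)) by (left; destruct r; reflexivity).
  pose proof (local_max_exchange _ _ _ _ _ _ _ _ _ _ _ _ _ _ _ _ _
                HM HP J1 J2 J3 Hperm) as Hle.
  set (D := dot (pull x e) (pull x f)) in *.
  set (X := cross (pull x e) (pull x f)) in *.
  assert (HX : D <= X <= - D).
  { pose proof (Rle_abs X). pose proof (Rle_abs (- X)). rewrite Rabs_Ropp in *. lra. }
  assert (O1 : dot (vsub a1 x) (vsub a2 x) <= 0).
  { rewrite A1, A2, dot_tilt. fold D X.
    assert (0 < p1 * p2) by nra.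
    (* The left side is affine in [X], hence largest at an end of [[D, -D]]: there it is
       [((1 - s)(1 + t) + 2 s t) D] if [t <= s], and [((1 + s)(1 - t) + 2 s t) D] otherwise. *)
    assert ((1 + s * t) * D + (s - t) * X <= 0).
    { assert (0 <= (1 - s) * (1 + t) * - D) by (apply Rmult_le_pos; nra).
      assert (0 <= (1 + s) * (1 - t) * - D) by (apply Rmult_le_pos; nra).
      destruct (Rle_lt_dec s t); nra. }
    nra. }
  assert (O2 : dot (vsub b1 x) (vsub b2 x) <= 0).
  { rewrite B1, B2, dot_tilt. fold D X.
    assert (0 < q1 * q2) by nra.
    assert ((1 + - s * - t) * D + (- s - - t) * X <= 0).
    { assert (0 <= (1 - s) * (1 + t) * - D) by (apply Rmult_le_pos; nra).
      assert (0 <= (1 + s) * (1 - t) * - D) by (apply Rmult_le_pos; nra).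
      destruct (Rle_lt_dec s t); nra. }
    nra. }
  apply obtuse_dist in O1, O2.
  rewrite (joins_excess _ _ _ _ J1) in Xe. rewrite (joins_excess _ _ _ _ J2) in Xf.
  pose proof (sqrt_pos 2).
  (* The distances from [x] to the four endpoints have one sum for both pairings. Positive excesses
     put it strictly above [sqrt 2] times the old length, the obtuse angles at most at [sqrt 2]
     times the new length. *)
  assert (sqrt 2 * (dist a1 a2 + dist b1 b2) <= sqrt 2 * (dist a1 b1 + dist a2 b2))
    by (apply Rmult_le_compat_l; lra).
  lra.
Qed.

Lemma local_max_pulls_no_triple (M : list edge) (x : point) (e f k : edge) :
  k_local_max 3 M -> In e M -> In f M -> In k M ->
  0 < excess x e -> 0 < excess x f -> 0 < excess x k ->
  dot (pull x e) (pull x f) <= 0 -> dot (pull x f) (pull x k) <= 0 ->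
  dot (pull x k) (pull x e) <= 0 ->
  0 <= cross (pull x e) (pull x f) -> 0 <= cross (pull x f) (pull x k) ->
  0 <= cross (pull x k) (pull x e) -> False.
Proof.
  intros HM He Hf Hk Xe Xf Xk D1 D2 D3 C1 C2 C3.
  assert (distinct : forall e f, 0 < excess x e ->
    dot (pull x e) (pull x f) <= 0 -> f <> e).
  { intros e' f' X D ->. pose proof (pull_nonzero x e' X). lra. }
  assert (Hfe := distinct e f Xe D1). assert (Hkf := distinct f k Xf D2).
  assert (Hek := distinct k e Xk D3).
  destruct (in_split _ _ He) as [l1 [l2 ->]].
  assert (Hf' : In f (l1 ++ l2)).
  { apply in_elt_inv in Hf. destruct Hf as [Hf|Hf]; [congruence|assumption]. }
  assert (Hk' : In k (l1 ++ l2)).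
  { apply in_elt_inv in Hk. destruct Hk as [Hk|Hk]; [congruence|assumption]. }
  destruct (in_split _ _ Hf') as [l3 [l4 E]].
  rewrite E in Hk'. apply in_elt_inv in Hk'. destruct Hk' as [Hk'|Hk']; [congruence|].
  destruct (in_split _ _ Hk') as [l5 [l6 E']].
  assert (HP : Permutation (l1 ++ e :: l2) (e :: f :: k :: l5 ++ l6)).
  { rewrite <- Permutation_middle, E, <- Permutation_middle, E', <- Permutation_middle.
    reflexivity. }
  destruct (pull_tilt x e Xe) as [a1 [b1 [s1 [p1 [q1 [J1 [S1 [Hp1 [Hq1 [A1 B1]]]]]]]]]].
  destruct (pull_tilt x f Xf) as [a2 [b2 [s2 [p2 [q2 [J2 [S2 [Hp2 [Hq2 [A2 B2]]]]]]]]]].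
  destruct (pull_tilt x k Xk) as [a3 [b3 [s3 [p3 [q3 [J3 [S3 [Hp3 [Hq3 [A3 B3]]]]]]]]]].
  (* [a_i] lies counterclockwise of its bisector and [b_i] clockwise, so matching
     [b_i] with [a_(i+1)] only widens the gaps between the bisectors. *)
  assert (Hperm : Permutation (b1 :: a2 :: b2 :: a3 :: b3 :: a1 :: nil)
                    (a1 :: b1 :: a2 :: b2 :: a3 :: b3 :: nil))
    by (symmetry; apply (Permutation_cons_append (b1 :: a2 :: b2 :: a3 :: b3 :: nil))).
  pose proof (local_max_exchange _ _ _ _ _ _ _ _ _ _ _ _ _ _ _ _ _
                HM HP J1 J2 J3 Hperm) as Hle.
  assert (obtuse : forall g h s t p q, 0 <= s < 1 -> 0 <= t < 1 -> 0 < p -> 0 < q ->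
    dot g h <= 0 -> 0 <= cross g h ->
    dot (scale q (tilt (- s) g)) (scale p (tilt t h)) <= 0).
  { intros g h s t p q Hs Ht Hp Hq HD HC. rewrite dot_tilt.
    assert (0 < q * p) by nra.
    assert ((1 + - s * t) * dot g h + (- s - t) * cross g h <= 0).
    { assert (0 <= 1 - s * t) by nra.
      assert (0 <= (1 - s * t) * - dot g h) by (apply Rmult_le_pos; lra).
      assert (0 <= (s + t) * cross g h) by (apply Rmult_le_pos; lra). lra. }
    nra. }
  assert (O1 : dot (vsub b1 x) (vsub a2 x) <= 0) by (rewrite B1, A2; apply obtuse; auto).
  assert (O2 : dot (vsub b2 x) (vsub a3 x) <= 0) by (rewrite B2, A3; apply obtuse; auto).
  assert (O3 : dot (vsub b3 x) (vsub a1 x) <= 0) by (rewrite B3, A1; apply obtuse; auto).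
  apply obtuse_dist in O1, O2, O3.
  rewrite (joins_excess _ _ _ _ J1) in Xe. rewrite (joins_excess _ _ _ _ J2) in Xf.
  rewrite (joins_excess _ _ _ _ J3) in Xk.
  pose proof (sqrt_pos 2).
  assert (sqrt 2 * (dist b1 a2 + dist b2 a3 + dist b3 a1)
          <= sqrt 2 * (dist a1 b1 + dist a2 b2 + dist a3 b3))
    by (apply Rmult_le_compat_l; lra).
  lra.
Qed.

(** * Decreasing all excesses along a direction *)

Definition shift (x : point) (s : R) (d : point) : point := vadd x (scale s d).

Lemma dist_shift (x a d : point) (s : R) :
  0 < dist x a ->
  dist (shift x s d) a
  <= dist x a - s * dot (unit_to x a) d + s * (s * (dot d d / (2 * dist x a))).
Proof.
  intros H. pose proof (dist_sqr x a) as E. pose proof (dist_sqr (shift x s d) a) as E'.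
  (* AM-GM: the right-hand side is [(A^2 + B^2) / (2 A)] with [A], [B] the
     distances of [a] to [x] and to the shifted point. *)
  apply Rmult_le_reg_l with (2 * dist x a); [lra|].
  replace (2 * dist x a * (_ - _ + _))
    with (dist x a * dist x a
          + (dist x a * dist x a - 2 * s * dot (vsub a x) d + s * s * dot d d)).
  2: { unfold unit_to, dot, scale; simpl. field. lra. }
  replace (dist x a * dist x a - 2 * s * dot (vsub a x) d + s * s * dot d d)
    with (dist (shift x s d) a * dist (shift x s d) a).
  2: { rewrite E, E'. unfold shift, dot, vsub, vadd, scale; simpl; ring. }
  pose proof (pow2_ge_0 (dist x a - dist (shift x s d) a)). lra.
Qed.

Lemma excess_lipschitz (x y : point) (e : edge) :
  excess x e <= excess y e + 2 * (Rabs (fst x - fst y) + Rabs (snd x - snd y)).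
Proof.
  pose proof (dist_le_abs x y). pose proof (dist_triangle x y (fst e)).
  pose proof (dist_triangle x y (snd e)). unfold excess. lra.
Qed.

(** If the excess equals [t], its first-order decrease beats the quadratic error of [dist_shift] for
    small [s]. Otherwise there is slack, which the Lipschitz bound preserves for small [s]. *)
Lemma excess_descent (x d : point) (t : R) (e : edge) :
  0 < t -> excess x e <= t -> (excess x e = t -> 0 < dot (pull x e) d) ->
  exists s0, 0 < s0 /\ forall s, 0 < s <= s0 -> excess (shift x s d) e < t.
Proof.
  intros Ht Hle Hact.
  destruct (Req_dec (excess x e) t) as [Heq|Hne].
  - specialize (Hact Heq).
    destruct (excess_pos_dist x e) as [Ha [Hb _]]; [lra|].
    set (C := dot d d / (2 * dist x (fst e)) + dot d d / (2 * dist x (snd e))).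
    assert (HC : 0 <= C).
    { pose proof (dot_self_nonneg d).
      unfold C; apply Rplus_le_le_0_compat; apply Rle_mult_inv_pos; lra. }
    (* [C] collects the quadratic coefficients of both endpoints; adding 1 makes the denominator
       positive and the final inequality strict. *)
    exists (dot (pull x e) d / (C + 1)). split.
    { apply Rdiv_lt_0_compat; lra. }
    intros s [Hs Hs0].
    assert (HsC : s * (C + 1) <= dot (pull x e) d).
    { apply Rmult_le_reg_r with (/ (C + 1)); [apply Rinv_0_lt_compat; lra|].
      rewrite Rmult_assoc, Rinv_r, Rmult_1_r by lra. exact Hs0. }
    pose proof (dist_shift x (fst e) d s Ha) as I1.
    pose proof (dist_shift x (snd e) d s Hb) as I2.
    assert (Ep : dot (pull x e) d = dot (unit_to x (fst e)) d + dot (unit_to x (snd e)) d)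
      by (unfold pull, dot, vadd; simpl; ring).
    assert (I3 : s * (s * C) < s * dot (pull x e) d)
      by (apply Rmult_lt_compat_l; lra).
    rewrite Ep in I3. unfold C in I3. unfold excess in *. lra.
  - set (L := 2 * (Rabs (fst d) + Rabs (snd d))).
    assert (HL : 0 <= L).
    { pose proof (Rabs_pos (fst d)). pose proof (Rabs_pos (snd d)). unfold L; lra. }
    exists ((t - excess x e) / (L + 1)). split.
    { apply Rdiv_lt_0_compat; lra. }
    intros s [Hs Hs0].
    assert (HsC : s * (L + 1) <= t - excess x e).
    { apply Rmult_le_reg_r with (/ (L + 1)); [apply Rinv_0_lt_compat; lra|].
      rewrite Rmult_assoc, Rinv_r, Rmult_1_r by lra. exact Hs0. }
    pose proof (excess_lipschitz (shift x s d) x e) as I.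
    replace (fst (shift x s d) - fst x) with (s * fst d) in I
      by (unfold shift, vadd, scale; simpl; ring).
    replace (snd (shift x s d) - snd x) with (s * snd d) in I
      by (unfold shift, vadd, scale; simpl; ring).
    rewrite !Rabs_mult, (Rabs_pos_eq s) in I by lra.
    unfold L in HsC. lra.
Qed.

Lemma excess_descent_all (x d : point) (t : R) (M : list edge) :
  0 < t -> (forall e, In e M -> excess x e <= t) ->
  (forall e, In e M -> excess x e = t -> 0 < dot (pull x e) d) ->
  exists s0, 0 < s0 /\
    forall s, 0 < s <= s0 -> forall e, In e M -> excess (shift x s d) e < t.
Proof.
  intros Ht. induction M as [|e M IH]; intros Hle Hact.
  - exists 1. split; [lra|]. intros s _ e [].
  - destruct IH as [s1 [H1 D1]]; [intros; apply Hle; simpl; auto|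
      intros; apply Hact; simpl; auto|].
    destruct (excess_descent x d t e) as [s2 [H2 D2]];
      [assumption|apply Hle; simpl; auto|apply Hact; simpl; auto|].
    exists (Rmin s1 s2). split; [apply Rmin_glb_lt; assumption|].
    intros s Hs e' [<-|He'].
    + apply D2. pose proof (Rmin_r s1 s2). lra.
    + apply D1; [|assumption]. pose proof (Rmin_l s1 s2). lra.
Qed.

(** * Minimising the largest excess *)

(** The initial value 0 truncates the maximum below, so a positive value is attained by an edge. *)
Definition max_excess (M : list edge) (x : point) : R :=
  fold_right (fun e => Rmax (excess x e)) 0 M.

Lemma max_excess_ge (M : list edge) (x : point) (e : edge) :
  In e M -> excess x e <= max_excess M x.
Proof.
  induction M as [|f M IH]; simpl; [intros []|].
  intros [<-|H]; [apply Rmax_l|]. eapply Rle_trans; [apply IH, H|apply Rmax_r].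
Qed.

Lemma max_excess_nonneg (M : list edge) (x : point) : 0 <= max_excess M x.
Proof.
  induction M; simpl; [lra|]. eapply Rle_trans; [eassumption|apply Rmax_r].
Qed.

Lemma max_excess_lt (M : list edge) (x : point) (t : R) :
  0 < t -> (forall e, In e M -> excess x e < t) -> max_excess M x < t.
Proof.
  intros Ht. induction M as [|f M IH]; simpl; intros H; [assumption|].
  apply Rmax_lub_lt; auto.
Qed.

Lemma max_excess_lipschitz (M : list edge) (x y : point) :
  max_excess M x <= max_excess M y + 2 * (Rabs (fst x - fst y) + Rabs (snd x - snd y)).
Proof.
  pose proof (Rabs_pos (fst x - fst y)). pose proof (Rabs_pos (snd x - snd y)).
  induction M as [|e M IH]; simpl; [lra|].
  pose proof (excess_lipschitz x y e).
  pose proof (Rmax_l (excess y e) (max_excess M y)).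
  pose proof (Rmax_r (excess y e) (max_excess M y)).
  apply Rmax_lub; lra.
Qed.

Lemma max_excess_argmin (M : list edge) :
  exists m, forall p, max_excess M m <= max_excess M p.
Proof.
  destruct M as [|e M]; [exists (0, 0); intros; simpl; lra|].
  set (a := fst e).
  (* Coercivity comes from one edge: its excess at [p] is at least [|pa| - sqrt 2 |e|], and beyond
     [K] this exceeds the value at the origin. *)
  apply lipschitz_min_2d with (L := 2)
    (K := max_excess (e :: M) (0, 0) + Rabs (fst a) + Rabs (snd a)
          + sqrt 2 * dist (fst e) (snd e)).
  - lra.
  - intros p q. apply max_excess_lipschitz.
  - intros p Hp.
    apply Rle_trans with (excess p e); [|apply max_excess_ge; left; reflexivity].
    unfold excess. fold a. pose proof (dist_nonneg p (snd e)).
    pose proof (abs_fst_le_dist p a). pose proof (abs_snd_le_dist p a).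
    pose proof (Rabs_triang_inv (fst p) (fst a)).
    pose proof (Rabs_triang_inv (snd p) (snd a)).
    pose proof (Rabs_pos (fst a)). pose proof (Rabs_pos (snd a)).
    fold a in Hp. destruct Hp; lra.
Qed.

Lemma local_max_common_point (M : list edge) :
  k_local_max 3 M -> (3 <= length M)%nat ->
  exists x, forall e, In e M -> excess x e <= 0.
Proof.
  intros HM Hlen. destruct (max_excess_argmin M) as [x Hx]. exists x.
  intros e0 He0. eapply Rle_trans; [apply max_excess_ge, He0|].
  apply Rnot_lt_le. intros Ht. set (t := max_excess M x) in *.
  set (active := fun e => if Req_EM_T (excess x e) t then true else false).
  assert (Hin : forall g, In g (map (pull x) (filter active M)) ->
            exists e, g = pull x e /\ In e M /\ 0 < excess x e).
  { intros g Hg. apply in_map_iff in Hg. destruct Hg as [e [<- He]].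
    apply filter_In in He. destruct He as [He Ha]. exists e.
    unfold active in Ha. destruct (Req_EM_T (excess x e) t); [|discriminate].
    repeat split; [assumption|lra]. }
  destruct (half_plane_of_no_spread (map (pull x) (filter active M))) as [d Hd].
  - intros g Hg. destruct (Hin g Hg) as [e [-> [He Xe]]]. apply pull_nonzero, Xe.
  - intros g h Hg Hh. destruct (Hin g Hg) as [e [-> [He Xe]]].
    destruct (Hin h Hh) as [f [-> [Hf Xf]]].
    apply local_max_pulls_not_spread with M; assumption.
  - intros g h k Hg Hh Hk. destruct (Hin g Hg) as [e [-> [He Xe]]].
    destruct (Hin h Hh) as [f [-> [Hf Xf]]].
    destruct (Hin k Hk) as [l [-> [Hl Xl]]].
    apply local_max_pulls_no_triple with M; assumption.
  - destruct (excess_descent_all x d t M) as [s [Hs Hdesc]].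
    + assumption.
    + intros e He. apply max_excess_ge, He.
    + intros e He Ee. apply Hd, in_map, filter_In. split; [assumption|].
      unfold active. destruct (Req_EM_T (excess x e) t); [reflexivity|contradiction].
    + assert (max_excess M (shift x s d) < t)
        by (apply max_excess_lt; [assumption|apply Hdesc; lra]).
      specialize (Hx (shift x s d)). lra.
Qed.

(** * Comparing both matchings with the distances from one point *)

Definition star (x : point) (P : list point) : R :=
  fold_right (fun a => Rplus (dist x a)) 0 P.

Lemma star_perm (x : point) (P Q : list point) :
  Permutation P Q -> star x P = star x Q.
Proof. induction 1; simpl; lra. Qed.

Lemma matching_le_star (x : point) (E : list edge) : w E <= star x (endpoints E).
Proof.
  induction E as [|e E IH]; [unfold w; simpl; lra|].
  unfold w in *; simpl. pose proof (dist_triangle (fst e) x (snd e)) as H.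
  rewrite (dist_sym (fst e) x) in H. lra.
Qed.

Lemma star_le_matching (x : point) (E : list edge) :
  (forall e, In e E -> excess x e <= 0) -> star x (endpoints E) <= sqrt 2 * w E.
Proof.
  induction E as [|e E IH]; intros H; [unfold w; simpl; lra|].
  assert (He : excess x e <= 0) by (apply H; left; reflexivity).
  assert (HE : star x (endpoints E) <= sqrt 2 * w E) by (apply IH; intros; apply H; right; assumption).
  unfold w, excess in *; simpl. lra.
Qed.

Lemma length_endpoints (E : list edge) : length (endpoints E) = (2 * length E)%nat.
Proof. induction E as [|e E IH]; simpl; [reflexivity|]. rewrite IH. simpl. lia. Qed.

Theorem theorem4 (P : list point) (M Mstar : list edge) :
  NoDup P ->
  Nat.Even (length P) ->
  (6 <= length P)%nat ->
  perfect_matching P M ->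
  k_local_max 3 M ->
  max_matching P Mstar ->
  w M >= / sqrt 2 * w Mstar.
Proof.
  intros _ _ Hlen HM Hloc [HMstar _].
  destruct (local_max_common_point M Hloc) as [x Hx].
  (* Six points give at least three edges. *)
  { pose proof (Permutation_length HM) as H. rewrite length_endpoints in H. lia. }
  pose proof (matching_le_star x Mstar) as H1.
  pose proof (star_le_matching x M Hx) as H2.
  rewrite (star_perm x _ _ HMstar) in H1. rewrite (star_perm x _ _ HM) in H2.
  assert (Hs : 0 < sqrt 2) by (apply sqrt_lt_R0; lra).
  apply Rle_ge, Rmult_le_reg_l with (sqrt 2); [assumption|].
  rewrite <- Rmult_assoc, Rinv_r, Rmult_1_l by lra. lra.
Qed.
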